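(* Let $(X,b,\mu)$ be a connected weighted graph satisfying the finiteness condition (FC). Let $V=V_1+V_2$, where $V_1,V_2\in C(X)$ are real-valued, $V_2(x)\geq 0$ for all $x\in X$, and assume that there exists $C\in\mathbb{R}$ such that $(\mathcal{L}_{V_1}u,u)\geq C\|u\|^2$ for all $u\in C_c(X)$. Assume that $\mathcal{L}_{V_1}|_{C_c(X)}$ is essentially self-adjoint in $\ell^2_\mu(X)$. Assume additionally that there exist numbers $a_1\geq 0$ and $a_2\geq 0$ such that $$\|V_2u\|\leq a_1\|\mathcal{L}_{V_1}u\|+a_2\|u\|\qquad\text{for all }u\in C_c(X).$$ Then $\mathcal{L}_{V}|_{C_c(X)}$ is essentially self-adjoint in $\ell^2_\mu(X)$.
   Context: A symmetric weighted graph $(X,b)$ is a countable set $X\neq\emptyset$ with a function $b\colon X\times X\to[0,\infty)$ such that $b(x,y)=b(y,x)$, $b(x,x)=0$ and $\sum_{z\in X}b(x,z)<\infty$ for all $x,y\in X$. Write $x\sim y$ if $b(x,y)>0$; the graph is connected if every two vertices $x,y$ can be joined by a finite path $x=x_0\sim x_1\sim\dots\sim x_n=y$. A weight is a function $\mu\colon X\to(0,\infty)$; $(X,b,\mu)$ is called a weighted graph. $C(X)$ is the set of all functions $X\to\mathbb{C}$, $C_c(X)$ the set of finitely supported ones. $\ell^2_\mu(X)$ is the Hilbert space of $f\in C(X)$ with $\sum_x\mu(x)|f(x)|^2<\infty$, with inner product $(f,g)=\sum_x\mu(x)f(x)\overline{g(x)}$ and norm $\|\cdot\|$. Finiteness condition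 (FC): for every $x\in X$ the function $y\mapsto b(x,y)/\mu(y)$ belongs to $\ell^2_\mu(X)$. For real-valued $V\in C(X)$, the formal Schrödinger operator $\mathcal{L}_V$ is defined on $\mathcal{F}=\{f\in C(X): \sum_{y}b(x,y)|f(y)|<\infty \text{ for all } x\in X\}$ by $\mathcal{L}_Vf(x)=\frac{1}{\mu(x)}\sum_{y\in X}b(x,y)(f(x)-f(y))+V(x)f(x)$. Under (FC), $\mathcal{L}_V$ maps $C_c(X)$ into $\ell^2_\mu(X)$ and $\mathcal{L}_V|_{C_c(X)}$ is a symmetric operator in $\ell^2_\mu(X)$. *)

(* Defs.v *)
From mathcomp Require Import all_boot all_order all_algebra.
From mathcomp Require Import all_classical all_reals all_analysis.
From mathcomp Require Import complex.

Set Implicit Arguments.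
Unset Strict Implicit.
Unset Printing Implicit Defensive.

Import Order.TTheory GRing.Theory Num.Theory.

Local Open Scope classical_set_scope.
Local Open Scope ring_scope.
Local Open Scope complex_scope.

Record weighted_graph (R : realType) (X : countType) := WeightedGraph {
  gedge : X -> X -> R;
  gweight : X -> R;
  graph_nonempty : [set: X] !=set0;
  gedge_ge0 : forall x y, 0 <= gedge x y;
  gedge_sym : forall x y, gedge x y = gedge y x;
  gedge_irr : forall x, gedge x x = 0;
  gedge_summable : forall x,
    (\esum_(z in [set: X]) (gedge x z)%:E < +oo)%E;
  gweight_gt0 : forall x, 0 < gweight x
}.

Definition connected_graph (R : realType) (X : countType)
    (G : weighted_graph R X) : Prop :=
  forall x y : X, exists p : seq X,
    path (fun u v => 0 < gedge G u v) x p /\ last x p = y.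

Section Sums.
Variables (R : realType) (X : countType).

(* Unordered sum of an absolutely summable family. [esum] is a supremum of
   finite partial sums, hence only meaningful for nonnegative terms, so the
   positive and the negative part are summed separately. The value is only
   meaningful under absolute summability. *)
Definition rsum (f : X -> R) : R :=
  fine (\esum_(x in [set: X]) ((EFin \o f)^\+)%E x) -
  fine (\esum_(x in [set: X]) ((EFin \o f)^\-)%E x).

Definition csum (f : X -> R[i]) : R[i] :=
  rsum (fun x => complex.Re (f x)) +i* rsum (fun x => complex.Im (f x)).

End Sums.

(* Since the weight is positive, an element of l^2_mu(X) is a genuine function;
   l^2_mu(X) is represented as a set of functions, and a (possibly unbounded)
   operator in it by its graph, a set of pairs of functions. *)
Section HilbertSpace.
Variables (R : realType) (X : countType) (mu : X -> R).
Implicit Types (f g u : X -> R[i]) (A : set ((X -> R[i]) * (X -> R[i]))).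

Definition l2sqnorm f : \bar R :=
  (\esum_(x in [set: X]) (mu x * Normc.normc (f x) ^+ 2)%:E)%E.

Definition l2 : set (X -> R[i]) := [set f | (l2sqnorm f < +oo)%E].

(* Only meaningful on [l2]: [fine +oo] is 0. *)
Definition l2norm f : R := Num.sqrt (fine (l2sqnorm f)).

Definition l2inner f g : R[i] := csum (fun x => (mu x)%:C * f x * (g x)^*%C).

Definition op_closure A : set ((X -> R[i]) * (X -> R[i])) :=
  [set p | [/\ l2 p.1, l2 p.2 & forall e : R, 0 < e -> exists2 q, A q &
    (l2sqnorm (p.1 \- q.1)%R + l2sqnorm (p.2 \- q.2)%R < e%:E)%E]].

Definition op_adjoint A : set ((X -> R[i]) * (X -> R[i])) :=
  [set p | [/\ l2 p.1, l2 p.2 &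
    forall q, A q -> l2inner q.2 p.1 = l2inner q.1 p.2]].

Definition densely_defined A : Prop :=
  forall f, l2 f -> forall e : R, 0 < e ->
    exists2 q, A q & (l2sqnorm (f \- q.1)%R < e%:E)%E.

(* A densely defined A has a single-valued adjoint, so that A = A^* forces A
   to be the graph of an operator. *)
Definition self_adjoint A : Prop := densely_defined A /\ A = op_adjoint A.

Definition essentially_self_adjoint A : Prop := self_adjoint (op_closure A).

End HilbertSpace.

Definition finitely_supported (R : realType) (X : countType) :
    set (X -> R[i]) := [set u | finite_set [set x | u x != 0]].

Section Schroedinger.
Variables (R : realType) (X : countType) (G : weighted_graph R X).
Implicit Types (V : X -> R) (f u : X -> R[i]).

Definition finiteness_condition : Prop :=
  forall x, l2 (gweight G) (fun y => (gedge G x y / gweight G y)%:C).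

Definition formal_domain : set (X -> R[i]) := [set f | forall x,
  (\esum_(y in [set: X]) (gedge G x y * Normc.normc (f y))%:E < +oo)%E].

(* The formal operator acts on [formal_domain], where the sum converges
   absolutely; off this domain its value is a junk value. *)
Definition schroedinger V f : X -> R[i] := fun x =>
  (gweight G x)^-1%:C * csum (fun y => (gedge G x y)%:C * (f x - f y))
  + (V x)%:C * f x.

Lemma finitely_supported_formal_domain :
  @finitely_supported R X `<=` formal_domain.
Proof.
move=> u fu x.
have -> : (\esum_(y in [set: X]) (gedge G x y * Normc.normc (u y))%:E =
    \esum_(y in [set y | u y != 0%R]) (gedge G x y * Normc.normc (u y))%:E)%E.
  rewrite [RHS]esum_mkcond; apply: eq_esum => y _.
  case: ifPn => //; rewrite notin_setE /= => /negP; rewrite negbK => /eqP ->.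
  by rewrite (_ : Normc.normc 0 = 0) ?mulr0// Normc.normc0.
have nn z : 0 <= Normc.normc z :> R by case: z => a b; exact: sqrtr_ge0.
rewrite esum_fset//; last by move=> y _; rewrite lee_fin mulr_ge0// gedge_ge0.
by rewrite fsumEFin// ltry.
Qed.

(* Graph of the restriction of the formal operator to C_c(X). *)
Definition schroedinger_Cc V : set ((X -> R[i]) * (X -> R[i])) :=
  [set (u, schroedinger V u) | u in @finitely_supported R X].

End Schroedinger.

(* Main.v *)
Require Import Defs.
From mathcomp Require Import all_boot all_order all_algebra.
From mathcomp Require Import all_classical all_reals all_analysis.
From mathcomp Require Import complex.
From mathcomp Require Import ring lra.

Set Implicit Arguments.
Unset Strict Implicit.
Unset Printing Implicit Defensive.

Import Order.TTheory GRing.Theory Num.Theory.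
Import numFieldNormedType.Exports.

Local Open Scope classical_set_scope.
Local Open Scope ring_scope.

(** The potential V2 may be large compared with the operator L1 of V1, so no
    perturbation series is available. What replaces it is positivity: writing L
    for the operator of V1 + V2, the minimal positive solution w of
    (L + c) w = delta is dominated by the minimal positive solution w1 of
    (L1 + c) w1 = delta, because adding V2 >= 0 can only decrease it.

    Take c so large that L1 + c >= 1 on finitely supported functions. The
    function w1 is square summable and solves its equation pointwise, so
    essential self-adjointness of L1 puts it in the domain of the closure of L1,
    and the relative bound puts V2 w1 in l^2. Since 0 <= w <= w1, also V2 w is
    in l^2, hence so is L1 w = delta - c w - V2 w; therefore w too is in the
    domain of the closure of L1. Finitely supported u converging to w in the
    graph norm of L1 have V2 u converging to V2 w, again by the relative bound,
    so (L + c) u converges to delta. Every point function is thus a limit of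
    elements of the range of L + c on finitely supported functions, this range
    is dense (delta_approx, dense_range_delta), and a symmetric operator that is
    at least 1 and has dense range is essentially self-adjoint
    (dense_range_Cc_core).

    The minimal positive solutions are built by a Jacobi iteration truncated to
    a growing finite set: L + c is a diagonal multiplication minus the
    nonnegative operator summing over neighbours, and the diagonal is at least
    1 by coercivity. The iterates are finitely supported, increase with the
    step, decrease in the potential, and are bounded in l^2 by coercivity, so
    the limit exists, is square summable and inherits the comparison.

    All this happens for real functions. The operators have real coefficients,
    so complex functions split into real and imaginary parts, and essential
    self-adjointness is equivalent to the real statement that the graph of the
    formal operator restricted to l^2 is the closure of its graph over finitely
    supported functions (ess_self_adjointP). *)

(** * Unordered sums as limits of partial sums *)

Section Sums.
Variables (R : realType) (X : countType).
Implicit Types f g : X -> R.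

(** Finite sets exhausting X. Summing over them turns unordered sums into limits
    of sequences. *)
Definition box n : seq X := pmap pickle_inv (iota 0 n).

Lemma mem_box n x : (x \in box n) = (pickle x < n)%N.
Proof.
rewrite mem_pmap; apply/mapP/idP => [[j] | xn].
  rewrite mem_iota add0n => /= j_n jx.
  by have := @pickle_invK X j; rewrite -jx /= => ->.
by exists (pickle x); rewrite ?mem_iota ?add0n //= pickleK_inv.
Qed.

Lemma box_uniq n : uniq (box n).
Proof. exact: (pmap_uniq (@pickle_invK X) (iota_uniq 0 n)). Qed.

Lemma boxS n : box n.+1 = box n ++ seq_of_opt (pickle_inv n).
Proof.
by rewrite /box -addn1 iotaD add0n pmap_cat /= /oapp; case: pickle_inv.
Qed.

Definition psum f n : R := \sum_(x <- box n) f x.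

Lemma psum_ge0 f n : (forall x, 0 <= f x) -> 0 <= psum f n.
Proof. by move=> f0; apply: sumr_ge0. Qed.

Lemma le_psum f g n : (forall x, f x <= g x) -> psum f n <= psum g n.
Proof. by move=> fg; apply: ler_sum. Qed.

Lemma psum_nondecreasing f : (forall x, 0 <= f x) ->
  nondecreasing_seq (psum f).
Proof.
move=> f0; apply/nondecreasing_seqP => n.
by rewrite /psum boxS big_cat /= lerDl sumr_ge0.
Qed.

Lemma psum_set f n : (psum f n)%:E =
  (\sum_(x \in [set` box n]) (f x)%:E)%E.
Proof. by rewrite -fsbig_seq ?box_uniq // sumEFin. Qed.

Lemma psum_le_esum f n : (forall x, 0 <= f x) ->
  ((psum f n)%:E <= \esum_(x in [set: X]) (f x)%:E)%E.
Proof.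
move=> f0; rewrite psum_set; apply: esum_ge.
by exists [set` box n]; [split => //; exact: finite_seq|].
Qed.

Lemma esum_le_psum f (M : R) : (forall x, 0 <= f x) ->
  (forall n, psum f n <= M) -> (\esum_(x in [set: X]) (f x)%:E <= M%:E)%E.
Proof.
move=> f0 fM; apply: ge_ereal_sup => _ [F [finF _] <-].
pose n := (\max_(x <- finmap.enum_fset (fset_set F)) pickle x).+1.
apply: (@le_trans _ _ (psum f n)%:E); last by rewrite lee_fin.
rewrite psum_set; apply: lee_fsum_nneg_subset => //; first exact: finite_seq.
  move=> x /= /set_mem xF; apply/mem_set; rewrite /= mem_box ltnS.
  by rewrite leq_bigmax_seq // in_fset_set // inE.
by move=> x _; rewrite lee_fin.
Qed.

(** Bounds on real partial sums are what the estimates below produce directly;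
    [abs_summableE] relates them to extended sums. *)
Definition abs_summable f := exists M : R, forall n,
  psum (fun x => `|f x|) n <= M.

Lemma abs_summableE f : abs_summable f <->
  (\esum_(x in [set: X]) (`|f x|)%:E < +oo)%E.
Proof.
split=> [[M fM]|].
  by apply: le_lt_trans (ltry M); apply: esum_le_psum.
move=> h; exists (fine (\esum_(x in [set: X]) (`|f x|)%:E)%E) => n.
rewrite -lee_fin fineK ?psum_le_esum // ge0_fin_numE //.
by apply: esum_ge0 => x _; rewrite lee_fin.
Qed.

Lemma abs_summable_ge0 f : (forall x, 0 <= f x) ->
  abs_summable f <-> (\esum_(x in [set: X]) (f x)%:E < +oo)%E.
Proof.
move=> f0; rewrite abs_summableE.
by under eq_esum => x _ do rewrite ger0_norm //.
Qed.

Lemma cvg_psum_esum f : (forall x, 0 <= f x) ->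
  (\esum_(x in [set: X]) (f x)%:E < +oo)%E ->
  psum f @ \oo --> fine (\esum_(x in [set: X]) (f x)%:E)%E.
Proof.
move=> f0 foo; set s := fine _.
have sE : (s%:E = \esum_(x in [set: X]) (f x)%:E)%E.
  by rewrite fineK // ge0_fin_numE // esum_ge0 // => x _; rewrite lee_fin.
have ub n : psum f n <= s by rewrite -lee_fin sE psum_le_esum.
have cv : cvgn (psum f).
  apply: nondecreasing_is_cvgn; first exact: psum_nondecreasing.
  by exists s => _ [n _ <-].
suff -> : s = limn (psum f) by [].
apply/eqP; rewrite eq_le; apply/andP; split.
  rewrite -lee_fin sE esum_le_psum // => n.
  by apply: nondecreasing_cvgn_le => //; exact: psum_nondecreasing.
by apply: limr_le => //; apply: nearW.
Qed.

Lemma abs_summable_le f g : abs_summable g -> (forall x, `|f x| <= `|g x|) ->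
  abs_summable f.
Proof.
by move=> [M gM] fg; exists M => n; apply: le_trans (gM n); exact: le_psum.
Qed.

Lemma abs_summableD f g : abs_summable f -> abs_summable g ->
  abs_summable (fun x => f x + g x).
Proof.
move=> [M fM] [N gN]; exists (M + N) => n.
apply: le_trans (lerD (fM n) (gN n)); rewrite /psum -big_split /=.
by apply: ler_sum => x _; exact: ler_normD.
Qed.

Lemma abs_summableZ a f : abs_summable f -> abs_summable (fun x => a * f x).
Proof.
move=> [M fM]; exists (`|a| * M) => n.
rewrite /psum; under eq_bigr do rewrite normrM.
by rewrite -mulr_sumr; apply: ler_wpM2l => //; exact: fM.
Qed.

(** Through this convergence, linearity and monotonicity of [rsum] reduce to
    those of finite sums and of limits. *)
Lemma cvg_psum f : abs_summable f -> psum f @ \oo --> rsum f.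
Proof.
move=> sf; rewrite /rsum funerpos funerneg.
have sp : abs_summable f^\+.
  apply: abs_summable_le sf _ => x; rewrite ger0_norm // /funrpos.
  by rewrite ge_max ler_norm normr_ge0.
have sn : abs_summable f^\-.
  apply: abs_summable_le sf _ => x; rewrite ger0_norm // /funrneg.
  by rewrite ge_max -normrN ler_norm normr_ge0.
have -> : psum f = psum f^\+ \- psum f^\-.
  apply/funext => n; rewrite /= /psum -sumrB; apply: eq_bigr => x _.
  by rewrite -[in LHS](funrposBneg f).
by apply: cvgB; apply: cvg_psum_esum => //; exact/abs_summable_ge0.
Qed.

Lemma rsum_unique f s : abs_summable f -> psum f @ \oo --> s -> rsum f = s.
Proof. by move=> sf fs; apply: cvg_unique (cvg_psum sf) fs. Qed.

Lemma rsumD f g : abs_summable f -> abs_summable g ->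
  rsum (fun x => f x + g x) = rsum f + rsum g.
Proof.
move=> sf sg; apply: rsum_unique; first exact: abs_summableD.
have -> : psum (fun x => f x + g x) = psum f \+ psum g.
  by apply/funext => n; rewrite /psum big_split.
by apply: cvgD; exact: cvg_psum.
Qed.

Lemma rsumZ a f : abs_summable f -> rsum (fun x => a * f x) = a * rsum f.
Proof.
move=> sf; apply: rsum_unique; first exact: abs_summableZ.
have -> : psum (fun x => a * f x) = (fun n => a * psum f n).
  by apply/funext => n; rewrite /psum mulr_sumr.
by apply: cvgM; [exact: cvg_cst | exact: cvg_psum].
Qed.

Lemma le_rsum f g : abs_summable f -> abs_summable g ->
  (forall x, f x <= g x) ->
  rsum f <= rsum g.
Proof.
move=> sf sg fg; apply: ler_cvg_to (cvg_psum sf) (cvg_psum sg) _.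
by apply: nearW => n; exact: le_psum.
Qed.

Lemma psum_le_rsum f n : abs_summable f -> (forall x, 0 <= f x) ->
  psum f n <= rsum f.
Proof.
move=> sf f0; rewrite -(cvg_lim _ (cvg_psum sf)) //.
apply: nondecreasing_cvgn_le; first exact: psum_nondecreasing.
by apply/cvg_ex; exists (rsum f); exact: cvg_psum.
Qed.

Lemma rsum_ge0 f : abs_summable f -> (forall x, 0 <= f x) -> 0 <= rsum f.
Proof.
by move=> sf f0; apply: le_trans (psum_le_rsum 0 sf f0); exact: psum_ge0.
Qed.

Lemma abs_summable_bounded f M : (forall x, 0 <= f x) ->
  (forall n, psum f n <= M) ->
  abs_summable f.
Proof.
by move=> f0 fM; exists M => n;
  under [X in psum X _]funext do rewrite ger0_norm //.
Qed.

Lemma rsum_le f M : abs_summable f -> (forall n, psum f n <= M) -> rsum f <= M.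
Proof.
move=> sf fM; rewrite -(cvg_lim _ (cvg_psum sf)) //; apply: limr_le;
  last exact: nearW.
by apply/cvg_ex; exists (rsum f); exact: cvg_psum.
Qed.

Lemma psum_supp f n m : (forall x, (n <= pickle x)%N -> f x = 0) ->
  (n <= m)%N ->
  psum f m = psum f n.
Proof.
move=> f0; elim: m => [|m IH]; first by rewrite leqn0 => /eqP ->.
rewrite leq_eqVlt => /predU1P[-> //|]; rewrite ltnS => nm.
rewrite /psum boxS big_cat /= -/(psum f m) (IH nm).
have := @pickle_invK X m; case: pickle_inv => [x|] /= xm;
  last by rewrite big_nil addr0.
by rewrite big_seq1 f0 ?addr0 // xm.
Qed.

Lemma abs_summable_supp f n : (forall x, (n <= pickle x)%N -> f x = 0) ->
  abs_summable f.
Proof.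
move=> f0; exists (psum (fun x => `|f x|) n) => m.
have g0 x : (n <= pickle x)%N -> `|f x| = 0 by move/f0 ->; rewrite normr0.
case: (leqP n m) => nm; first by rewrite (psum_supp g0 nm).
exact: (psum_nondecreasing (fun x => normr_ge0 (f x))) (ltnW nm).
Qed.

Lemma rsum_supp f n : (forall x, (n <= pickle x)%N -> f x = 0) ->
  rsum f = psum f n.
Proof.
move=> f0; apply: rsum_unique; first exact: abs_summable_supp f0.
apply: cvg_near_cst; near=> m; apply: psum_supp => //.
near: m; exact: nbhs_infty_ge.
Unshelve. all: by end_near.
Qed.

Lemma rsum_single f y : (forall x, x != y -> f x = 0) -> rsum f = f y.
Proof.
move=> f0; rewrite (@rsum_supp f (pickle y).+1); last first.
  by move=> x xy; apply: f0; apply: contraTneq xy => ->; rewrite ltnn.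
by rewrite /psum (bigD1_seq y) ?box_uniq ?mem_box //= big1 ?addr0.
Qed.

End Sums.

(** * Real weighted l^2 spaces *)

Section WeightedL2.
Variables (R : realType) (X : countType) (mu : X -> R).
Hypothesis mu_gt0 : forall x, 0 < mu x.
Implicit Types f g h : X -> R.

Definition L2 f := abs_summable (fun x => mu x * (f x * f x)).
Definition ip f g : R := rsum (fun x => mu x * (f x * g x)).
Definition nrm f : R := Num.sqrt (ip f f).

Lemma weighted_sqr_ge0 f x : 0 <= mu x * (f x * f x).
Proof. by apply: mulr_ge0; [exact: ltW | exact: sqr_ge0]. Qed.

Lemma summable_mul f g : L2 f -> L2 g ->
  abs_summable (fun x => mu x * (f x * g x)).
Proof.
move=> Lf Lg; apply: abs_summable_le (abs_summableD Lf Lg) _ => x.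
have m0 := ltW (mu_gt0 x).
rewrite -mulrDr !normrM ler_wpM2l // -normrM ler_norml ger0_norm; nra.
Qed.

Lemma L2D f g : L2 f -> L2 g -> L2 (f + g).
Proof.
move=> Lf Lg.
have := abs_summableD (abs_summableD Lf Lg) (abs_summableZ 2 (summable_mul Lf
  Lg)).
by congr abs_summable; apply/funext => x; rewrite !fctE; ring.
Qed.

Lemma L2Z a f : L2 f -> L2 (a *: f).
Proof.
move=> Lf; have := abs_summableZ (a * a) Lf.
by congr abs_summable; apply/funext => x; rewrite !fctE /GRing.scale /=; ring.
Qed.

Lemma L2N f : L2 f -> L2 (- f).
Proof. by rewrite -scaleN1r; exact: L2Z. Qed.

Lemma L2B f g : L2 f -> L2 g -> L2 (f - g).
Proof. by move=> Lf Lg; apply: L2D => //; exact: L2N. Qed.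

Lemma ipC f g : ip f g = ip g f.
Proof. by congr rsum; apply/funext => x; rewrite (mulrC (f x)). Qed.

Lemma ipDl f g h : L2 f -> L2 g -> L2 h -> ip (f + g) h = ip f h + ip g h.
Proof.
move=> Lf Lg Lh; rewrite /ip -(rsumD (summable_mul Lf Lh) (summable_mul Lg Lh)).
by congr rsum; apply/funext => x; rewrite !fctE; ring.
Qed.

Lemma ipZl a f h : L2 f -> L2 h -> ip (a *: f) h = a * ip f h.
Proof.
move=> Lf Lh; rewrite /ip -(rsumZ a (summable_mul Lf Lh)).
by congr rsum; apply/funext => x; rewrite !fctE /GRing.scale /=; ring.
Qed.

Lemma ipNl f h : L2 f -> L2 h -> ip (- f) h = - ip f h.
Proof. by move=> Lf Lh; rewrite -scaleN1r ipZl // mulN1r. Qed.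

Lemma ipBl f g h : L2 f -> L2 g -> L2 h -> ip (f - g) h = ip f h - ip g h.
Proof. by move=> Lf Lg Lh; rewrite ipDl ?ipNl //; exact: L2N. Qed.

Lemma ipDr f g h : L2 f -> L2 g -> L2 h -> ip h (f + g) = ip h f + ip h g.
Proof. by move=> *; rewrite !(ipC h) ipDl. Qed.

Lemma ipBr f g h : L2 f -> L2 g -> L2 h -> ip h (f - g) = ip h f - ip h g.
Proof. by move=> *; rewrite !(ipC h) ipBl. Qed.

Lemma ipZr a f h : L2 f -> L2 h -> ip h (a *: f) = a * ip h f.
Proof. by move=> *; rewrite !(ipC h) ipZl. Qed.

Lemma ip_ge0 f : L2 f -> 0 <= ip f f.
Proof. by move=> Lf; apply: rsum_ge0 => // x; exact: weighted_sqr_ge0. Qed.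

Lemma nrm_ge0 f : 0 <= nrm f. Proof. exact: sqrtr_ge0. Qed.

Lemma sqr_nrm f : L2 f -> nrm f ^+ 2 = ip f f.
Proof. by move=> Lf; rewrite sqr_sqrtr // ip_ge0. Qed.

Lemma nrmZ a f : L2 f -> nrm (a *: f) = `|a| * nrm f.
Proof.
move=> Lf; rewrite /nrm ipZl ?ipZr //; last exact: L2Z.
by rewrite mulrA -expr2 sqrtrM ?sqr_ge0 // sqrtr_sqr.
Qed.

Lemma nrmN f : L2 f -> nrm (- f) = nrm f.
Proof. by move=> Lf; rewrite -scaleN1r nrmZ // normrN1 mul1r. Qed.

Lemma cauchy_schwarz f g : L2 f -> L2 g -> ip f g <= nrm f * nrm g.
Proof.
move=> Lf Lg.
have quad t : 0 <= nrm f ^+ 2 - 2 * t * ip f g + t ^+ 2 * nrm g ^+ 2.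
  have Ltg := L2Z t Lg; have := ip_ge0 (L2B Lf Ltg).
  rewrite ipBl ?ipBr ?ipZl ?ipZr //; last exact: L2B.
  by rewrite (ipC g f) -!sqr_nrm //; congr (0 <= _); ring.
have f0 := nrm_ge0 f; have g0 := nrm_ge0 g.
move: (ip f g) (nrm f) (nrm g) quad f0 g0 => p F G quad F0.
rewrite le_eqVlt => /predU1P[G0|G0].
  (* the quadratic degenerates to an affine function of t; this t makes it
     negative *)
  rewrite -G0 mulr0 leNgt; apply/negP => p0.
  have := quad ((F ^+ 2 + 1) / (2 * p)).
  have -> : 2 * ((F ^+ 2 + 1) / (2 * p)) * p = F ^+ 2 + 1 by field; lra.
  rewrite -G0 expr0n /= mulr0; lra.
(* the minimizer of the quadratic *)
have := quad (p / G ^+ 2).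
have -> : F ^+ 2 - 2 * (p / G ^+ 2) * p + (p / G ^+ 2) ^+ 2 * G ^+ 2 =
   F ^+ 2 - (p / G) ^+ 2 by field; lra.
rewrite subr_ge0 => h; rewrite -ler_pdivrMr //.
by rewrite (le_trans (ler_norm _)) // -ler_sqr ?nnegrE // real_normK ?num_real.
Qed.

Lemma norm_ip f g : L2 f -> L2 g -> `|ip f g| <= nrm f * nrm g.
Proof.
move=> Lf Lg; rewrite ler_norml cauchy_schwarz // andbT lerNl -ipNl //.
by rewrite -(nrmN Lf) cauchy_schwarz //; exact: L2N.
Qed.

Lemma nrmD f g : L2 f -> L2 g -> nrm (f + g) <= nrm f + nrm g.
Proof.
move=> Lf Lg; have Lfg := L2D Lf Lg.
rewrite -ler_sqr ?nnegrE ?addr_ge0 ?nrm_ge0 // sqr_nrm // ipDl ?ipDr //.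
rewrite (ipC g f) -!sqr_nrm //.
have := cauchy_schwarz Lf Lg; nra.
Qed.

Lemma nrmB f g : L2 f -> L2 g -> nrm (f - g) <= nrm f + nrm g.
Proof. by move=> Lf Lg; rewrite -(nrmN Lg) nrmD //; exact: L2N. Qed.

Lemma nrm_trans f g h : L2 f -> L2 g -> L2 h ->
  nrm (f - h) <= nrm (f - g) + nrm (g - h).
Proof.
move=> Lf Lg Lh; have -> : f - h = (f - g) + (g - h) by rewrite addrA subrK.
by apply: nrmD; exact: L2B.
Qed.

Lemma L2_le f g : L2 g -> (forall x, `|f x| <= `|g x|) -> L2 f.
Proof.
move=> Lg fg; apply: abs_summable_le Lg _ => x.
by rewrite !normrM ler_wpM2l // ler_pM.
Qed.

Lemma nrm_le f g : L2 g -> (forall x, `|f x| <= `|g x|) -> nrm f <= nrm g.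
Proof.
move=> Lg fg; have Lf := L2_le Lg fg.
apply: ler_wsqrtr; apply: le_rsum => // x.
rewrite ler_wpM2l ?(ltW (mu_gt0 x)) //.
rewrite -!expr2 -(real_normK (num_real (f x))) -(real_normK (num_real (g x))).
by rewrite ler_sqr ?nnegrE.
Qed.

Lemma ip_pointwise f : L2 f -> forall x, mu x * (f x * f x) <= ip f f.
Proof.
move=> Lf x.
have sq := weighted_sqr_ge0 f.
apply: le_trans (psum_le_rsum (pickle x).+1 Lf sq).
by rewrite /psum (bigD1_seq x) ?box_uniq ?mem_box //= lerDl sumr_ge0.
Qed.

(** Finite support, expressed by a bound on the enumeration so that supports are
    contained in boxes. *)
Definition Cc f := exists n, forall x, (n <= pickle x)%N -> f x = 0.

Definition delta (y x : X) : R := (x == y)%:R.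

Lemma CcD f g : Cc f -> Cc g -> Cc (f + g).
Proof.
move=> [n fn] [m gm]; exists (maxn n m) => x.
by rewrite geq_max => /andP[nx mx]; rewrite fctE fn // gm // addr0.
Qed.

Lemma CcZ a f : Cc f -> Cc (a *: f).
Proof.
by move=> [n fn]; exists n => x /fn fx; rewrite fctE fx scaler0.
Qed.

Lemma CcB f g : Cc f -> Cc g -> Cc (f - g).
Proof. by move=> cf cg; rewrite -scaleN1r; apply: CcD => //; exact: CcZ. Qed.

Lemma Cc0 : Cc 0. Proof. by exists 0%N. Qed.

Lemma Cc_delta y : Cc (delta y).
Proof.
exists (pickle y).+1 => x; rewrite /delta; case: eqP => // ->.
by rewrite ltnn.
Qed.

Lemma Cc_L2 f : Cc f -> L2 f.
Proof.
move=> [n fn]; apply: (@abs_summable_supp _ _ _ n) => x /fn ->.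
by rewrite mul0r mulr0.
Qed.

Definition trunc n f x : R := if (pickle x < n)%N then f x else 0.

Lemma Cc_trunc n f : Cc (trunc n f).
Proof. by exists n => x; rewrite /trunc ltnNge => ->. Qed.

(** The point functions span the finitely supported ones, so linear statements
    need only be checked on them. *)
Lemma Cc_ind (P : (X -> R) -> Prop) : P 0 ->
  (forall f a y, Cc f -> P f -> P (f + a *: delta y)) ->
  forall f, Cc f -> P f.
Proof.
move=> P0 Pd f [n fn].
have -> : f = trunc n f.
  by apply/funext => x; rewrite /trunc ltnNge; case: leqP => //= /fn.
elim: {fn} n => [|n IH].
  by have -> : trunc 0 f = 0 by apply/funext => x; rewrite /trunc ltn0.
case En : (pickle_inv n : option X) => [y|].
  have yn : pickle y = n by have := @pickle_invK X n; rewrite En.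
  have -> : trunc n.+1 f = trunc n f + f y *: delta y.
    apply/funext => x; rewrite !fctE /trunc /delta /GRing.scale /= ltnS.
    rewrite leq_eqVlt -yn (inj_eq (pcan_inj (@pickleK_inv X))).
    by case: eqP => [->|_] /=; rewrite ?ltnn ?add0r ?mulr1 ?mulr0 ?addr0.
  by apply: Pd => //; exact: Cc_trunc.
have -> // : trunc n.+1 f = trunc n f.
apply/funext => x; rewrite /trunc ltnS leq_eqVlt; case: eqP => //= xn.
by move: En; rewrite -xn pickleK_inv.
Qed.

Lemma summable_mul_Cc u h : Cc u -> abs_summable (fun x => mu x * (u x * h x)).
Proof.
by move=> [n un]; apply: (@abs_summable_supp _ _ _ n) => x /un ->;
  rewrite mul0r mulr0.
Qed.

Lemma ip0l h : ip 0 h = 0.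
Proof.
rewrite /ip (@rsum_supp _ _ _ 0%N) ?/psum ?big_nil // => x _.
by rewrite mul0r mulr0.
Qed.

Lemma ipDl_Cc u v h : Cc u -> Cc v -> ip (u + v) h = ip u h + ip v h.
Proof.
move=> cu cv; rewrite /ip -rsumD;
  [|exact: summable_mul_Cc|exact: summable_mul_Cc].
by congr rsum; apply/funext => x; rewrite !fctE; ring.
Qed.

Lemma ipZl_Cc a u h : Cc u -> ip (a *: u) h = a * ip u h.
Proof.
move=> cu; rewrite /ip -rsumZ; last exact: summable_mul_Cc.
by congr rsum; apply/funext => x; rewrite !fctE /GRing.scale /=; ring.
Qed.

Lemma ip_delta f y : ip (delta y) f = mu y * f y.
Proof.
rewrite /ip (@rsum_single _ _ _ y) /delta ?eqxx ?mul1r // => x /negbTE ->.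
by rewrite mul0r mulr0.
Qed.

Lemma Cc_dense f : L2 f -> forall e : R, 0 < e ->
  exists2 u, Cc u & nrm (f - u) < e.
Proof.
move=> Lf e e0.
pose g x := mu x * (f x * f x).
have /cvgrPdist_lt /(_ _ (exprn_gt0 2 e0)) [n _ /(_ n (leqnn n)) /= h] :=
  cvg_psum Lf.
exists (trunc n f); first exact: Cc_trunc.
have Lt := Cc_L2 (Cc_trunc n f); have Lft := L2B Lf Lt.
rewrite -ltr_sqr ?nnegrE ?nrm_ge0 ?ltW // sqr_nrm //.
apply: le_lt_trans h; apply: le_trans (ler_norm _).
have -> : psum g n = ip (trunc n f) (trunc n f).
  rewrite /ip (@rsum_supp _ _ _ n); last first.
    by move=> x; rewrite /trunc ltnNge => -> /=; rewrite mul0r mulr0.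
  by apply: eq_big_seq => x; rewrite mem_box /trunc => ->.
rewrite lerBrDr -(rsumD Lft Lt) le_eqVlt; apply/orP; left; apply/eqP.
congr rsum; apply/funext => x; rewrite !fctE /trunc.
by case: ifP => _; ring.
Qed.

End WeightedL2.

Arguments delta {R X} y x.

(** * The formal operator on real functions *)

Section RealOperator.
Variables (R : realType) (X : countType) (G : weighted_graph R X).
Local Notation b := (gedge G).
Local Notation mu := (gweight G).
Let mu_gt0 := gweight_gt0 G.
Local Notation L2 := (L2 mu).
Local Notation ip := (ip mu).
Local Notation nrm := (nrm mu).
Hypothesis FC : forall x, L2 (fun y => b x y / mu y).
Implicit Types (f g u V : X -> R).

Definition edge_sum f x : R := rsum (fun y => b x y * f y).

(** Splitting the sum of differences exhibits the operator as multiplication by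
    [diagonal V] minus [edge_sum] divided by the weight. *)
Definition diagonal V x : R := rsum (b x) / mu x + V x.

Definition rschroedinger V f : X -> R := fun x =>
  (mu x)^-1 * rsum (fun y => b x y * (f x - f y)) + V x * f x.

Lemma summable_degree x : abs_summable (b x).
Proof.
by apply/abs_summable_ge0; [exact: gedge_ge0 | exact: gedge_summable].
Qed.

(** This is where the finiteness condition enters: the sum is the l^2 pairing
    of f with the square summable function y |-> b x y / mu y. *)
Lemma summable_edge f x : L2 f -> abs_summable (fun y => b x y * f y).
Proof.
move=> Lf; have := summable_mul mu_gt0 (FC x) Lf.
congr abs_summable; apply/funext => y.
by rewrite mulrA mulrCA divff ?mulr1 // gt_eqF.
Qed.

Lemma rschroedingerE V f x : L2 f ->
  rschroedinger V f x = diagonal V x * f x - edge_sum f x / mu x.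
Proof.
move=> Lf; rewrite /rschroedinger /edge_sum /diagonal.
have -> : (fun y => b x y * (f x - f y)) =
    (fun y => f x * b x y + (-1) * (b x y * f y)).
  by apply/funext => y; ring.
have sb := summable_degree x; have sf := summable_edge x Lf.
by rewrite (rsumD (abs_summableZ _ sb) (abs_summableZ _ sf)) !rsumZ //; ring.
Qed.

Lemma edge_sumD f g x : L2 f -> L2 g ->
  edge_sum (f + g) x = edge_sum f x + edge_sum g x.
Proof.
move=> Lf Lg; rewrite /edge_sum -rsumD;
  [|exact: summable_edge|exact: summable_edge].
by congr rsum; apply/funext => y; rewrite fctE mulrDr.
Qed.

Lemma edge_sumZ a f x : L2 f -> edge_sum (a *: f) x = a * edge_sum f x.
Proof.
move=> Lf; rewrite /edge_sum -rsumZ; last exact: summable_edge.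
by congr rsum; apply/funext => y; rewrite fctE /GRing.scale /= mulrCA.
Qed.

Lemma rschroedingerD V f g : L2 f -> L2 g ->
  rschroedinger V (f + g) = rschroedinger V f + rschroedinger V g.
Proof.
move=> Lf Lg; apply/funext => x; have Lfg := L2D mu_gt0 Lf Lg.
by rewrite !fctE (rschroedingerE _ _ Lfg) (rschroedingerE _ _ Lf)
  (rschroedingerE _ _ Lg) edge_sumD // !fctE; ring.
Qed.

Lemma rschroedingerZ V a f : L2 f ->
  rschroedinger V (a *: f) = a *: rschroedinger V f.
Proof.
move=> Lf; apply/funext => x; have Laf := L2Z a Lf.
by rewrite !fctE (rschroedingerE _ _ Laf) (rschroedingerE _ _ Lf) edge_sumZ //
  !fctE /GRing.scale /=; ring.
Qed.

Lemma rschroedingerB V f g : L2 f -> L2 g ->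
  rschroedinger V (f - g) = rschroedinger V f - rschroedinger V g.
Proof.
by move=> Lf Lg; rewrite -scaleN1r rschroedingerD ?rschroedingerZ ?scaleN1r //;
  exact: L2N.
Qed.

Lemma rschroedinger_add V W f :
  rschroedinger (V + W) f = rschroedinger V f + W * f.
Proof. by apply/funext => x; rewrite /rschroedinger !fctE; ring. Qed.

Lemma edge_sum_delta y x : edge_sum (delta y) x = b x y.
Proof.
rewrite /edge_sum (@rsum_single _ _ _ y) /delta ?eqxx ?mulr1 // => z /negbTE ->.
by rewrite mulr0.
Qed.

Lemma rschroedinger_delta V y :
  rschroedinger V (delta y) = diagonal V y *: delta y - (fun x => b y x / mu x).
Proof.
apply/funext => x; rewrite rschroedingerE; last exact: Cc_L2 (Cc_delta R y).
rewrite edge_sum_delta gedge_sym !fctE /GRing.scale /= /delta.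
by case: eqP => [->|] //; rewrite !mulr0.
Qed.

Lemma rschroedinger0 V : rschroedinger V 0 = 0.
Proof.
have L0 : L2 0 := Cc_L2 mu (@Cc0 R X).
by rewrite -[X in rschroedinger _ X](scale0r 0) rschroedingerZ ?scale0r.
Qed.

Lemma rschroedinger_L2 V u : Cc u -> L2 (rschroedinger V u).
Proof.
move: u; apply: Cc_ind => [|u a y cu Lu].
  by rewrite rschroedinger0; exact: Cc_L2 (@Cc0 R X).
have Ld : L2 (delta y) by exact: Cc_L2 (Cc_delta _ _).
rewrite rschroedingerD ?rschroedingerZ //; [|exact: Cc_L2|exact: L2Z].
apply: L2D => //; apply: L2Z; rewrite rschroedinger_delta.
by apply: L2B => //; exact: L2Z.
Qed.

(** Green's formula. On a point function it is the definition of the operator,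
    by symmetry of the edge weights. *)
Lemma green V u f : Cc u -> L2 f ->
  ip (rschroedinger V u) f = ip u (rschroedinger V f).
Proof.
move=> cu Lf; move: u cu; apply: Cc_ind => [|u a y cu IH].
  by rewrite rschroedinger0 !ip0l.
have Lu := Cc_L2 mu cu; have Ld := Cc_L2 mu (Cc_delta R y).
have cd := CcZ a (Cc_delta R y).
have LLd := rschroedinger_L2 V (Cc_delta R y).
rewrite rschroedingerD ?rschroedingerZ //; last exact: L2Z.
rewrite ipDl ?ipZl //; [|exact: rschroedinger_L2|exact: L2Z].
rewrite ipDl_Cc // ipZl_Cc //; last exact: Cc_delta.
rewrite IH ip_delta; congr (_ + a * _).
rewrite rschroedinger_delta ipBl ?ipZl //; last exact: L2Z.
rewrite ip_delta rschroedingerE // mulrBr mulrCA; congr (_ - _).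
rewrite mulrCA divff ?mulr1 ?gt_eqF // /ip /edge_sum.
congr rsum; apply/funext => x.
by rewrite mulrA mulrCA divff ?mulr1 // gt_eqF.
Qed.

End RealOperator.

(** * Minimal positive solutions *)

Section MinimalSolution.
Variables (R : realType) (X : countType) (G : weighted_graph R X).
Local Notation b := (gedge G).
Local Notation mu := (gweight G).
Let mu_gt0 := gweight_gt0 G.
Local Notation L2 := (L2 mu).
Local Notation ip := (ip mu).
Hypothesis FC : forall x, L2 (fun y => b x y / mu y).
Local Notation rschroedinger := (rschroedinger G).
Local Notation edge_sum := (edge_sum G).
Local Notation diagonal := (diagonal G).
Implicit Types (f g u U V : X -> R).

Definition coercive U := forall u, Cc u -> ip u u <= ip (rschroedinger U u) u.

(** Coercivity on the point function at x, since there is no loop at x. *)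
Lemma diagonal_ge1 U x : coercive U -> 1 <= diagonal U x.
Proof.
move=> /(_ _ (Cc_delta R x)).
rewrite ip_delta (ipC mu (rschroedinger U _)) ip_delta.
rewrite rschroedingerE //; last exact: Cc_L2 (Cc_delta R x).
rewrite edge_sum_delta gedge_irr mul0r subr0 /delta eqxx !mulr1.
by rewrite -[leLHS]mulr1 ler_pM2l.
Qed.

Lemma edge_sum_ge0 f x : L2 f -> (forall y, 0 <= f y) -> 0 <= edge_sum f x.
Proof.
move=> Lf f0; apply: rsum_ge0; first exact: summable_edge.
by move=> y; rewrite mulr_ge0 ?gedge_ge0.
Qed.

Lemma le_edge_sum f g x : L2 f -> L2 g -> (forall y, f y <= g y) ->
  edge_sum f x <= edge_sum g x.
Proof.
move=> Lf Lg fg; apply: le_rsum; [exact: summable_edge|exact: summable_edge|].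
by move=> y; rewrite ler_wpM2l ?gedge_ge0.
Qed.

Variable x0 : X.

(** The equation diagonal * w = edge_sum w / mu + delta is solved by iteration.
    Truncating each step keeps the iterates finitely supported, which a graph
    with infinitely many neighbours would otherwise destroy. *)
Fixpoint jacobi U k : X -> R :=
  if k is k'.+1 then
    trunc k
      (fun x => (edge_sum (jacobi U k') x / mu x + delta x0 x) / diagonal U x)
  else 0.

Lemma jacobiS U k x : jacobi U k.+1 x = if (pickle x < k.+1)%N then
  (edge_sum (jacobi U k) x / mu x + delta x0 x) / diagonal U x else 0.
Proof. by []. Qed.

Lemma Cc_jacobi U k : Cc (jacobi U k).
Proof. by case: k => [|k]; [exact: Cc0 | exact: Cc_trunc]. Qed.

Let L2_jacobi U k : L2 (jacobi U k).
Proof. exact/Cc_L2/Cc_jacobi. Qed.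

Lemma delta_ge0 x : 0 <= delta x0 x :> R.
Proof. by rewrite /delta ler0n. Qed.

Lemma jacobi_ge0 U k x : coercive U -> 0 <= jacobi U k x.
Proof.
move=> cU; elim: k x => [|k IH] x //=; rewrite /trunc; case: ifP => // _.
apply: divr_ge0; last exact: le_trans ler01 (diagonal_ge1 x cU).
by rewrite addr_ge0 ?delta_ge0 // divr_ge0 ?(ltW (mu_gt0 x)) // edge_sum_ge0.
Qed.

Lemma jacobi_le U k x : coercive U -> jacobi U k x <= jacobi U k.+1 x.
Proof.
move=> cU; elim: k x => [|k IH] x; first exact: jacobi_ge0.
case: (ltnP (pickle x) k.+1) => xk; last first.
  have -> : jacobi U k.+1 x = 0 by rewrite /= /trunc ltnNge xk.
  exact: jacobi_ge0.
rewrite (jacobiS U k) (jacobiS U k.+1) xk (ltn_trans xk) //.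
rewrite ler_wpM2r ?invr_ge0 ?(le_trans ler01 (diagonal_ge1 x cU)) //.
by rewrite lerD2r ler_wpM2r ?invr_ge0 ?(ltW (mu_gt0 x)) // le_edge_sum.
Qed.

(** A larger potential means a larger diagonal to divide by, and the rest of the
    iteration is monotone on nonnegative functions. *)
Lemma jacobi_antitone U V k x : coercive U -> coercive V ->
  (forall x, U x <= V x) -> jacobi V k x <= jacobi U k x.
Proof.
move=> cU cV UV; elim: k x => [|k IH] x //=; rewrite /trunc; case: ifP => // _.
have U0 := lt_le_trans ltr01 (diagonal_ge1 x cU).
have V0 := lt_le_trans ltr01 (diagonal_ge1 x cV).
apply: ler_pM; rewrite ?invr_ge0 ?(ltW V0) //.
- rewrite addr_ge0 ?delta_ge0 // divr_ge0 ?(ltW (mu_gt0 x)) //.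
  by rewrite edge_sum_ge0 // => y; exact: jacobi_ge0.
- by rewrite lerD2r ler_wpM2r ?invr_ge0 ?(ltW (mu_gt0 x)) // le_edge_sum.
- by rewrite lef_pV2 ?posrE // /diagonal lerD2l.
Qed.

Lemma diagonal_jacobi U k x : coercive U -> (pickle x < k.+1)%N ->
  diagonal U x * jacobi U k.+1 x = edge_sum (jacobi U k) x / mu x + delta x0 x.
Proof.
move=> cU xk; rewrite /= /trunc xk mulrC divfK // gt_eqF //.
exact: lt_le_trans (diagonal_ge1 x cU).
Qed.

(** Since the iterates increase, each one is a subsolution on its support.
    Pairing the inequality with the iterate w itself and using coercivity gives
    ip w w <= mu x0 * w x0. As mu x0 * w x0 ^+ 2 <= ip w w, this forces
    w x0 <= 1, hence the bound, uniform in the step. *)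
Lemma jacobi_energy U k : coercive U ->
  ip (jacobi U k) (jacobi U k) <= mu x0.
Proof.
move=> cU; case: k => [|k]; first by rewrite ip0l ltW.
set w := jacobi U k.+1.
have cw : Cc w := Cc_jacobi U k.+1; have Lw := Cc_L2 mu cw.
have LLw := rschroedinger_L2 FC U cw.
have Ld : L2 (delta x0) := Cc_L2 mu (Cc_delta R x0).
have h : ip w w <= mu x0 * w x0.
  apply: le_trans (cU _ cw) _; rewrite -(ip_delta mu).
  apply: le_rsum => [||x]; [exact: summable_mul|exact: summable_mul|].
  rewrite ler_wpM2l ?(ltW (mu_gt0 x)) //.
  case: (ltnP (pickle x) k.+1) => xk; last first.
    by rewrite /w /= /trunc ltnNge xk /= !mulr0.
  rewrite ler_wpM2r ?jacobi_ge0 // rschroedingerE // diagonal_jacobi //.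
  rewrite addrAC gerDr subr_le0 ler_wpM2r ?invr_ge0 ?(ltW (mu_gt0 x)) //.
  by apply: le_edge_sum => // y; exact: jacobi_le.
have h1 := ip_pointwise mu_gt0 Lw x0.
have w0 : 0 <= w x0 := jacobi_ge0 k.+1 x0 cU.
have m0 := mu_gt0 x0.
have h2 : mu x0 * (w x0 * w x0) <= mu x0 * w x0 by exact: le_trans h1 h.
apply: le_trans h _; rewrite ger_pMr //.
by rewrite leNgt; apply/negP => w1; move: h2; rewrite ler_pM2l //; nra.
Qed.

Lemma psum_ip_le f n : L2 f -> psum (fun x => mu x * (f x * f x)) n <= ip f f.
Proof. by move=> Lf; apply: psum_le_rsum => // x; exact: weighted_sqr_ge0. Qed.

Definition minsol U x := limn (fun k => jacobi U k x).

Section Limit.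
Variable U : X -> R.
Hypothesis cU : coercive U.

Lemma jacobi_nd x : nondecreasing_seq (fun k => jacobi U k x).
Proof. by apply/nondecreasing_seqP => k; exact: jacobi_le. Qed.

Lemma cvg_jacobi x : (fun k => jacobi U k x) @ \oo --> minsol U x.
Proof.
apply: nondecreasing_is_cvgn; first exact: jacobi_nd.
exists (1 + mu x0 / mu x) => _ [k _ <-].
have := le_trans (ip_pointwise mu_gt0 (L2_jacobi U k) x) (jacobi_energy k cU).
rewrite -ler_pdivlMl // [leRHS]mulrC => h.
apply: (@le_trans _ _ (1 + jacobi U k x * jacobi U k x)); first by nra.
by rewrite lerD2l.
Qed.

Lemma jacobi_le_minsol k x : jacobi U k x <= minsol U x.
Proof.
apply: (@nondecreasing_cvgn_le _ (fun k => jacobi U k x));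
  first exact: jacobi_nd.
by apply/cvg_ex; exists (minsol U x); exact: cvg_jacobi.
Qed.

Lemma minsol_ge0 x : 0 <= minsol U x.
Proof. by apply: le_trans (jacobi_le_minsol 0 x). Qed.

Lemma cvg_psum_jacobi (F : X -> R -> R) n :
  (forall x, F x (jacobi U k x) @[k --> \oo] --> F x (minsol U x)) ->
  psum (fun x => F x (jacobi U k x)) n @[k --> \oo] -->
  psum (fun x => F x (minsol U x)) n.
Proof. by move=> h; apply: (cvg_big add_continuous) => x _; exact: h. Qed.

(** Fatou's lemma for the bound [jacobi_energy]. *)
Lemma minsol_L2 : L2 (minsol U).
Proof.
apply: (@abs_summable_bounded _ _ _ (mu x0)) => [x|n].
  exact: weighted_sqr_ge0.
have cv :
    psum (fun x => mu x * (jacobi U k x * jacobi U k x)) n @[k --> \oo] -->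
    psum (fun x => mu x * (minsol U x * minsol U x)) n.
  apply: (@cvg_psum_jacobi (fun x t => mu x * (t * t))) => x.
  by apply: cvgM; [exact: cvg_cst|apply: cvgM; exact: cvg_jacobi].
rewrite -(cvg_lim _ cv) //; apply: limr_le.
  by apply/cvg_ex; eexists; exact: cv.
apply: nearW => k; apply: le_trans (jacobi_energy k cU).
exact: psum_ip_le.
Qed.

(** Monotone convergence. One inequality bounds the iterates on the right by the
    limit; the other bounds finite parts of the sum over neighbours before they
    are let grow. *)
Lemma rschroedinger_minsol : rschroedinger U (minsol U) = delta x0.
Proof.
apply/funext => x; rewrite rschroedingerE //; last exact: minsol_L2.
have sw := summable_edge FC x minsol_L2.
have cv : (fun k => diagonal U x * jacobi U k.+1 x) @ \oo -->
    diagonal U x * minsol U x.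
  apply: cvgM; first exact: cvg_cst.
  by have := @cvg_jacobi x; rewrite -(cvg_shiftS (fun k => jacobi U k x)).
have ub : diagonal U x * minsol U x <=
  edge_sum (minsol U) x / mu x + delta x0 x.
  rewrite -(cvg_lim _ cv) //; apply: limr_le.
    by apply/cvg_ex; eexists; exact: cv.
  near=> k; rewrite diagonal_jacobi //; last by near: k; exact: nbhs_infty_ge.
  rewrite lerD2r ler_wpM2r ?invr_ge0 ?(ltW (mu_gt0 x)) // le_edge_sum //;
    first exact: minsol_L2.
  by move=> y; exact: jacobi_le_minsol.
have lb : edge_sum (minsol U) x <=
  mu x * (diagonal U x * minsol U x - delta x0 x).
  apply: rsum_le => // n.
  have cn : psum (fun y => b x y * jacobi U k y) n @[k --> \oo] -->
      psum (fun y => b x y * minsol U y) n.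
    apply: (@cvg_psum_jacobi (fun y t => b x y * t)) => y.
    by apply: cvgM; [exact: cvg_cst|exact: cvg_jacobi].
  rewrite -(cvg_lim _ cn) //; apply: limr_le.
    by apply/cvg_ex; eexists; exact: cn.
  near=> k.
  have jk : abs_summable (fun y => b x y * jacobi U k y).
    exact: summable_edge.
  apply: le_trans (psum_le_rsum n jk _) _.
    by move=> y; rewrite mulr_ge0 ?gedge_ge0 ?jacobi_ge0.
  rewrite -/(edge_sum _ x) -ler_pdivrMl // mulrC lerBrDr -diagonal_jacobi //;
    last first.
    by near: k; exact: nbhs_infty_ge.
  rewrite ler_wpM2l ?jacobi_le_minsol //.
  exact: le_trans ler01 (diagonal_ge1 x cU).
move: lb; rewrite -ler_pdivrMl // mulrC => lb.
by apply/eqP; rewrite eq_le; apply/andP; split; lra.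
Unshelve. all: by end_near.
Qed.

End Limit.

Lemma minsol_antitone U V x : coercive U -> coercive V ->
  (forall x, U x <= V x) -> minsol V x <= minsol U x.
Proof.
move=> cU cV UV; apply: ler_cvg_to (@cvg_jacobi V cV x) (@cvg_jacobi U cU x) _.
by apply: nearW => k; exact: jacobi_antitone.
Qed.

End MinimalSolution.

(** * Perturbation by a nonnegative potential *)

Section Perturbation.
Variables (R : realType) (X : countType) (G : weighted_graph R X).
Local Notation b := (gedge G).
Local Notation mu := (gweight G).
Let mu_gt0 := gweight_gt0 G.
Local Notation L2 := (L2 mu).
Local Notation ip := (ip mu).
Local Notation nrm := (nrm mu).
Hypothesis FC : forall x, L2 (fun y => b x y / mu y).
Local Notation rschroedinger := (rschroedinger G).
Local Notation coercive := (coercive G).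
Implicit Types (f g u U V W : X -> R).

(** The pair (f, g) is in the closure of the graph of the operator on finitely
    supported functions. *)
Definition graph_approx V f g := forall e, 0 < e -> exists u,
  [/\ Cc u, nrm (f - u) < e & nrm (g - rschroedinger V u) < e].

(** The finitely supported functions are a core of the maximal operator, the one
    with domain all f in l^2 whose image is in l^2. *)
Definition Cc_core V := forall f, L2 f -> L2 (rschroedinger V f) ->
  graph_approx V f (rschroedinger V f).

Definition rel_bounded V W a1 a2 := forall u, Cc u ->
  nrm (W * u) <= a1 * nrm (rschroedinger V u) + a2 * nrm u.

Lemma CcM W u : Cc u -> Cc (W * u).
Proof.
by move=> [n un]; exists n => x /un; rewrite fctE => ->; rewrite mulr0.
Qed.

(** The bound passes to the closure by Fatou's lemma: on a finite set
    multiplication by W is continuous, so there W * f is the limit of the W * u,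
    and the resulting estimate does not depend on the finite set. *)
Lemma rel_bounded_ext V W a1 a2 f g : 0 <= a1 -> 0 <= a2 ->
  rel_bounded V W a1 a2 -> L2 f -> L2 g -> graph_approx V f g ->
  L2 (W * f) /\ nrm (W * f) <= a1 * nrm g + a2 * nrm f.
Proof.
move=> a10 a20 bd Lf Lg ap; set M := a1 * nrm g + a2 * nrm f.
have M0 : 0 <= M by rewrite addr_ge0 ?mulr_ge0 ?nrm_ge0.
have tr n : nrm (trunc n (W * f)) <= M.
  pose K := psum (fun x => `|W x|) n.
  have K0 : 0 <= K by exact: psum_ge0.
  apply/ler_addgt0Pr => e e0.
  have c0 : 0 < a1 + a2 + K + 1 by rewrite ltr_wpDl // !addr_ge0.
  have [u [cu fu gu]] := ap (e / (a1 + a2 + K + 1)) (divr_gt0 e0 c0).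
  have Lu := Cc_L2 mu cu; have LLu := rschroedinger_L2 FC V cu.
  have Lfu := L2B mu_gt0 Lf Lu.
  have -> : trunc n (W * f) = trunc n (W * u) + trunc n (W * (f - u)).
    by apply/funext => x; rewrite !fctE /trunc; case: ifP => _; ring.
  apply: le_trans (nrmD mu_gt0 _ _) _;
    [exact/Cc_L2/Cc_trunc|exact/Cc_L2/Cc_trunc|].
  have h1 : nrm (trunc n (W * u)) <= nrm (W * u).
    apply: nrm_le => // [|x]; first exact/Cc_L2/CcM.
    by rewrite /trunc; case: ifP => _ //; rewrite normr0.
  have h2 : nrm (trunc n (W * (f - u))) <= K * nrm (f - u).
    rewrite -[K in leRHS]ger0_norm // -(nrmZ mu_gt0) //.
    apply: nrm_le => // [|x]; first exact: L2Z.
    rewrite /trunc; case: ifP => [xn|_]; last by rewrite normr0.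
    rewrite [leLHS]normrM [leRHS]normrM ler_wpM2r // (ger0_norm K0).
    by rewrite /K /psum (bigD1_seq x) ?box_uniq ?mem_box //= lerDl sumr_ge0.
  have h3 : nrm u <= nrm f + nrm (f - u).
    have := nrmB mu_gt0 Lf Lfu; congr (nrm _ <= _).
    by rewrite opprB addrC subrK.
  have h4 : nrm (rschroedinger V u) <= nrm g + nrm (g - rschroedinger V u).
    have := nrmB mu_gt0 Lg (L2B mu_gt0 Lg LLu); congr (nrm _ <= _).
    by rewrite opprB addrC subrK.
  set d := e / _ in fu gu.
  have dE : (a1 + a2 + K + 1) * d = e by rewrite mulrC divfK // gt_eqF.
  have d0 : 0 < d by rewrite divr_gt0.
  have := bd u cu; rewrite /M.
  have h5 : K * nrm (f - u) <= K * d by rewrite ler_wpM2l // ltW.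
  have h6 : a1 * nrm (rschroedinger V u) <= a1 * (nrm g + d).
    by rewrite ler_wpM2l // (le_trans h4) // lerD2l ltW.
  have h7 : a2 * nrm u <= a2 * (nrm f + d).
    by rewrite ler_wpM2l // (le_trans h3) // lerD2l ltW.
  by lra.
have ps n : psum (fun x => mu x * ((W * f) x * (W * f) x)) n <= M ^+ 2.
  have -> : psum (fun x => mu x * ((W * f) x * (W * f) x)) n =
      ip (trunc n (W * f)) (trunc n (W * f)).
    rewrite /ip (@rsum_supp _ _ _ n); last first.
      by move=> x; rewrite /trunc ltnNge => -> /=; rewrite mul0r mulr0.
    by apply: eq_big_seq => x; rewrite mem_box /trunc => ->.
  rewrite -sqr_nrm //; last exact/Cc_L2/Cc_trunc.
  by rewrite ler_sqr ?nnegrE ?nrm_ge0.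
have LWf : L2 (W * f).
  apply: abs_summable_bounded ps => x.
  exact: weighted_sqr_ge0.
split=> //; rewrite -ler_sqr ?nnegrE ?nrm_ge0 // sqr_nrm //.
exact: rsum_le.
Qed.

Lemma graph_approx_subl V f g u : L2 f -> L2 g -> Cc u -> graph_approx V f g ->
  graph_approx V (f - u) (g - rschroedinger V u).
Proof.
move=> Lf Lg cu ap e e0; have [v [cv fv gv]] := ap e e0.
have Lu := Cc_L2 mu cu; have Lv := Cc_L2 mu cv.
exists (v - u); split; first exact: CcB.
  by rewrite opprB addrA subrK.
by rewrite rschroedingerB // opprB addrA subrK.
Qed.

Lemma coercive_add U W : coercive U -> (forall x, 0 <= W x) -> coercive (U + W).
Proof.
move=> cU W0 u cu; have Lu := Cc_L2 mu cu.
have LW := Cc_L2 mu (CcM W cu).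
rewrite rschroedinger_add ipDl //; last exact: rschroedinger_L2.
apply: le_trans (cU u cu) _; rewrite lerDl.
apply: rsum_ge0 => [|x]; first exact: summable_mul.
rewrite fctE -mulrA; apply: mulr_ge0; first exact: ltW.
by apply: mulr_ge0; [exact: W0 | exact: sqr_ge0].
Qed.

Definition dense_range U := forall h, L2 h -> forall e : R, 0 < e ->
  exists2 u, Cc u & nrm (h - rschroedinger U u) < e.

(** The heart of the argument: w <= w1 carries square summability of W * w1 over
    to W * w, which places w in the domain of the closure of the unperturbed
    operator; finitely supported approximants of w in the graph norm of U are
    then approximants for U + W as well. *)
Lemma delta_approx U W a1 a2 x0 : coercive U -> (forall x, 0 <= W x) ->
  0 <= a1 -> 0 <= a2 -> rel_bounded U W a1 a2 -> Cc_core U ->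
  forall e : R, 0 < e ->
  exists2 u, Cc u & nrm (delta x0 - rschroedinger (U + W) u) < e.
Proof.
move=> cU W0 a10 a20 bd eU e e0.
have cUW := coercive_add cU W0.
have Ld : L2 (delta x0) := Cc_L2 mu (Cc_delta R x0).
pose w1 := minsol G x0 U; pose w := minsol G x0 (U + W).
have Lw1 : L2 w1 := minsol_L2 FC x0 cU.
have Lw : L2 w := minsol_L2 FC x0 cUW.
have LWw1 : L2 (W * w1).
  have E : rschroedinger U w1 = delta x0 := rschroedinger_minsol FC x0 cU.
  have := eU w1 Lw1; rewrite E => /(_ Ld) ap.
  by have [] := rel_bounded_ext a10 a20 bd Lw1 Ld ap.
have LWw : L2 (W * w).
  apply: L2_le LWw1 _ => // x; rewrite ![`|(W * _) x|]normrM ler_wpM2l //.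
  rewrite !ger0_norm ?minsol_ge0 // minsol_antitone // => z.
  by rewrite fctE lerDl.
have E : rschroedinger U w = delta x0 - W * w.
  by rewrite -(rschroedinger_minsol FC x0 cUW) rschroedinger_add addrK.
have LLw : L2 (rschroedinger U w) by rewrite E; exact: L2B.
have c0 : 0 < 1 + a1 + a2 by rewrite -addrA ltr_wpDr // addr_ge0.
have d0 : 0 < e / (1 + a1 + a2) by exact: divr_gt0.
have [u [cu wu Lwu]] := eU w Lw LLw _ d0.
exists u => //.
have Lu := Cc_L2 mu cu; have LLu := rschroedinger_L2 FC U cu.
have LD : L2 (rschroedinger U w - rschroedinger U u) by exact: L2B.
have [LWd Wd] := rel_bounded_ext a10 a20 bd (L2B mu_gt0 Lw Lu) LD
  (graph_approx_subl Lw LLw cu (eU w Lw LLw)).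
have -> : delta x0 - rschroedinger (U + W) u =
  (rschroedinger U w - rschroedinger U u) + W * (w - u).
  by rewrite E rschroedinger_add; apply/funext => x; rewrite !fctE; ring.
apply: le_lt_trans (nrmD mu_gt0 LD LWd) _.
move: (e / _) d0 (divfK (lt0r_neq0 c0) e) wu Lwu => d d0 dE wu Lwu.
have h6 : a1 * nrm (rschroedinger U w - rschroedinger U u) <= a1 * d.
  by rewrite ler_wpM2l // ltW.
have h7 : a2 * nrm (w - u) <= a2 * d by rewrite ler_wpM2l // ltW.
by lra.
Qed.

Lemma dense_range_delta U :
  (forall x0 (e : R), 0 < e ->
    exists2 u, Cc u & nrm (delta x0 - rschroedinger U u) < e) ->
  dense_range U.
Proof.
move=> dl h Lh e e0.
have fin : forall v, Cc v -> forall e : R, 0 < e ->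
    exists2 u, Cc u & nrm (v - rschroedinger U u) < e.
  apply: Cc_ind => [d d0|v a y cv IH d d0].
    exists 0; first exact: Cc0.
    by rewrite (rschroedinger0 FC) subr0 /nrm ip0l sqrtr0.
  have [u1 cu1 h1] := IH (d / 2) (divr_gt0 d0 (ltr0Sn R 1)).
  have a0 : 0 < `|a| + 1 by rewrite ltr_wpDl.
  have d2 : 0 < d / 2 / (`|a| + 1) by rewrite !divr_gt0.
  have [u2 cu2 h2] := dl y (d / 2 / (`|a| + 1)) d2.
  have L1 := Cc_L2 mu cu1; have L2' := Cc_L2 mu cu2.
  have Ld := Cc_L2 mu (Cc_delta R y).
  have LL1 := rschroedinger_L2 FC U cu1; have LL2 := rschroedinger_L2 FC U cu2.
  have LD := L2B mu_gt0 Ld LL2.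
  exists (u1 + a *: u2); first by apply: CcD => //; exact: CcZ.
  have Lau : L2 (a *: u2) by exact: L2Z.
  rewrite (rschroedingerD FC U L1 Lau) (rschroedingerZ FC) //.
  have -> : v + a *: delta y - (rschroedinger U u1 + a *: rschroedinger U u2) =
      (v - rschroedinger U u1) + a *: (delta y - rschroedinger U u2).
    by apply/funext => x; rewrite !fctE /GRing.scale /=; ring.
  apply: le_lt_trans (nrmD mu_gt0 _ _) _.
  - by apply: L2B => //; exact: Cc_L2.
  - exact: L2Z.
  rewrite nrmZ //.
  have : (`|a| + 1) * nrm (delta y - rschroedinger U u2) < d / 2.
    by rewrite mulrC -ltr_pdivlMr.
  have := nrm_ge0 mu (delta y - rschroedinger U u2); lra.
have [v cv hv] := Cc_dense mu_gt0 Lh (divr_gt0 e0 (ltr0Sn R 1)).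
have [u cu vu] := fin v cv _ (divr_gt0 e0 (ltr0Sn R 1)).
exists u => //.
have Lv := Cc_L2 mu cv; have LLu := rschroedinger_L2 FC U cu.
apply: le_lt_trans (nrm_trans mu_gt0 Lh Lv LLu) _.
by rewrite [ltRHS]splitr ltrD.
Qed.

Lemma coercive_nrm U z : coercive U -> Cc z -> nrm z <= nrm (rschroedinger U z).
Proof.
move=> cU cz; have Lz := Cc_L2 mu cz; have LLz := rschroedinger_L2 FC U cz.
have := le_trans (cU z cz) (cauchy_schwarz mu_gt0 LLz Lz).
rewrite -sqr_nrm // expr2.
have := nrm_ge0 mu z; rewrite le_eqVlt => /predU1P[<- _|z0];
  first exact: nrm_ge0.
by rewrite ler_pM2r.
Qed.

(** If the image of u is close to that of f, then u is close to f: the error d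
    pairs with the image of z as the error r of the images pairs with z, by
    Green's formula, and z is bounded by its image. Approximating d by images
    turns this into nrm d <= nrm r. Comparing u directly with the given f avoids
    constructing a limit of the u. *)
Lemma dense_range_Cc_core U : coercive U -> dense_range U -> Cc_core U.
Proof.
move=> cU dU f Lf LLf e e0.
have [u cu hu] := dU _ LLf e e0.
exists u; split => //; apply: le_lt_trans hu.
have Lu := Cc_L2 mu cu; have LLu := rschroedinger_L2 FC U cu.
have Ld := L2B mu_gt0 Lf Lu; have Lr := L2B mu_gt0 LLf LLu.
set d := f - u in Ld *; set r := rschroedinger U f - rschroedinger U u in Lr *.
have key : nrm d * nrm d <= nrm r * nrm d.
  have d0 := nrm_ge0 mu d; have r0 := nrm_ge0 mu r.
  apply/ler_addgt0Pr => t t0.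
  have c0 : 0 < nrm d + nrm r + 1 by rewrite ltr_wpDl // addr_ge0.
  have [z cz dz] := dU d Ld (t / (nrm d + nrm r + 1)) (divr_gt0 t0 c0).
  have Lz := Cc_L2 mu cz; have LLz := rschroedinger_L2 FC U cz.
  have Ldz := L2B mu_gt0 Ld LLz.
  have h1 : nrm d * nrm d = ip d (d - rschroedinger U z) + ip z r.
    rewrite -expr2 sqr_nrm // ipBr // (ipC _ d (rschroedinger U z)).
    rewrite (green FC U cz Ld).
    by rewrite /d /r (rschroedingerB FC U Lf Lu) subrK.
  have h2 := cauchy_schwarz mu_gt0 Ld Ldz.
  have h3 := cauchy_schwarz mu_gt0 Lz Lr.
  have h4 : nrm z <= nrm d + nrm (d - rschroedinger U z).
    apply: le_trans (coercive_nrm cU cz) _.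
    have := nrmB mu_gt0 Ld Ldz; congr (nrm _ <= _).
    by rewrite opprB addrC subrK.
  move: (t / _) (divfK (lt0r_neq0 c0) t) dz => q qE dz.
  have h5 : nrm d * nrm (d - rschroedinger U z) <= nrm d * q.
    by rewrite ler_wpM2l // ltW.
  have h6 : nrm z * nrm r <= (nrm d + q) * nrm r.
    by rewrite ler_wpM2r // (le_trans h4) // lerD2l ltW.
  have q0 : 0 < q := le_lt_trans (nrm_ge0 _ _) dz.
  rewrite h1; move: h2 h3 h5 h6 qE; lra.
have := nrm_ge0 mu d; rewrite le_eqVlt => /predU1P[<-|d0]; first exact: nrm_ge0.
by rewrite -(ler_pM2r d0).
Qed.

Lemma cstM c f : cst c * f = c *: f. Proof. exact/funext. Qed.

(** Multiplication by a constant is bounded, so graph approximation is the same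
    before and after the shift. *)
Lemma Cc_core_shift V c : Cc_core V -> Cc_core (V + cst c).
Proof.
move=> eV f Lf; rewrite rschroedinger_add cstM => Lg.
have LVf : L2 (rschroedinger V f).
  by rewrite -(addrK (c *: f) (rschroedinger V f)); apply: L2B => //;
    exact: L2Z.
move=> e e0.
have c0 : 0 < `|c| + 1 by rewrite ltr_wpDl.
have [u [cu fu gu]] := eV f Lf LVf (e / (`|c| + 1)) (divr_gt0 e0 c0).
have Lu := Cc_L2 mu cu; have LLu := rschroedinger_L2 FC V cu.
have Lfu := L2B mu_gt0 Lf Lu; have n0 := nrm_ge0 mu (f - u).
move: (e / _) (divfK (lt0r_neq0 c0) e) fu gu => q qE fu gu.
have q0 : 0 < q := le_lt_trans n0 fu.
have cn0 := normr_ge0 c.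
exists u; split => //; first by apply: lt_le_trans fu _; nra.
rewrite rschroedinger_add cstM.
have -> : rschroedinger V f + c *: f - (rschroedinger V u + c *: u) =
  (rschroedinger V f - rschroedinger V u) + c *: (f - u).
  by apply/funext => x; rewrite !fctE /GRing.scale /=; ring.
apply: le_lt_trans (nrmD mu_gt0 _ _) _; [exact: L2B|exact: L2Z|].
rewrite nrmZ //.
have h : `|c| * nrm (f - u) <= `|c| * q by rewrite ler_wpM2l // ltW.
by lra.
Qed.

Lemma Cc_core_perturb V W C a1 a2 : (forall x, 0 <= W x) ->
  (forall u, Cc u -> C * ip u u <= ip (rschroedinger V u) u) ->
  0 <= a1 -> 0 <= a2 -> rel_bounded V W a1 a2 ->
  Cc_core V -> Cc_core (V + W).
Proof.
move=> W0 hC a10 a20 bd eV.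
(* shift the potential so that the lower bound becomes 1 *)
pose c := 1 - C; pose U := V + cst c.
have cU : coercive U.
  move=> u cu; have Lu := Cc_L2 mu cu; have LLu := rschroedinger_L2 FC V cu.
  rewrite rschroedinger_add cstM ipDl ?ipZl //; last exact: L2Z.
  by have := hC u cu; rewrite /c; lra.
have eU : Cc_core U by exact: Cc_core_shift.
have bU : rel_bounded U W a1 (a2 + a1 * `|c|).
  move=> u cu; have Lu := Cc_L2 mu cu; have LLu := rschroedinger_L2 FC U cu.
  apply: le_trans (bd u cu) _.
  have -> : rschroedinger V u = rschroedinger U u - c *: u.
    by rewrite rschroedinger_add cstM addrK.
  have Lcu := L2Z c Lu.
  have := ler_wpM2l a10 (nrmB mu_gt0 LLu Lcu); rewrite nrmZ //; lra.
have aa : 0 <= a2 + a1 * `|c| by rewrite addr_ge0 // mulr_ge0.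
have -> : V + W = (U + W) + cst (- c).
  by rewrite /U; apply/funext => x; rewrite !fctE; ring.
apply: Cc_core_shift; apply: dense_range_Cc_core.
  exact: coercive_add.
apply: dense_range_delta => x0; exact: delta_approx cU W0 a10 aa bU eU.
Qed.

End Perturbation.

(** * Real and imaginary parts *)

Section Complexification.
Variables (R : realType) (X : countType).
Implicit Types (f g u : X -> R[i]) (h : X -> R).

Definition repart f : X -> R := fun x => complex.Re (f x).
Definition impart f : X -> R := fun x => complex.Im (f x).
Definition cplx h : X -> R[i] := fun x => (h x +i* 0)%C.
Definition assemble (h k : X -> R) : X -> R[i] := fun x => (h x +i* k x)%C.

Lemma esum_rsum h : (forall x, 0 <= h x) -> abs_summable h ->
  (\esum_(x in [set: X]) (h x)%:E = (rsum h)%:E)%E.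
Proof.
move=> h0 sh; have h1 := (abs_summable_ge0 h0).1 sh.
rewrite (rsum_unique sh (cvg_psum_esum h0 h1)) fineK // ge0_fin_numE //.
by apply: esum_ge0 => x _; rewrite lee_fin.
Qed.

Lemma finitely_supportedP f :
  finitely_supported f <-> Cc (repart f) /\ Cc (impart f).
Proof.
split=> [fin|[[n fn] [m fm]]].
  pose supp := finmap.enum_fset (fset_set [set x | f x != 0]).
  pose n := (\max_(x <- supp) pickle x).+1.
  have fn x : (n <= pickle x)%N -> f x = 0.
    move=> nx; apply/eqP; apply: contraTT nx => fx.
    by rewrite -ltnNge ltnS leq_bigmax_seq // in_fset_set // inE.
  by split; exists n => x /fn; rewrite /repart /impart => ->.
apply: (@sub_finite_set _ _ [set` box X (maxn n m)]); last exact: finite_seq.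
move=> x /=; apply: contraNT; rewrite mem_box -leqNgt geq_max => /andP[nx mx].
by have := fn x nx; have := fm x mx; rewrite /repart /impart;
  case: (f x) => a b /= -> ->.
Qed.

Lemma Re_realM (a : R) (z : R[i]) :
  complex.Re (real_complex R a * z) = a * complex.Re z.
Proof. by case: z => c d /=; rewrite mul0r subr0. Qed.

Lemma Im_realM (a : R) (z : R[i]) :
  complex.Im (real_complex R a * z) = a * complex.Im z.
Proof. by case: z => c d /=; rewrite mul0r addr0. Qed.

Lemma ReD (z w : R[i]) : complex.Re (z + w) = complex.Re z + complex.Re w.
Proof. by case: z w => a c []. Qed.

Lemma ImD (z w : R[i]) : complex.Im (z + w) = complex.Im z + complex.Im w.
Proof. by case: z w => a c []. Qed.

Lemma ReB (z w : R[i]) : complex.Re (z - w) = complex.Re z - complex.Re w.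
Proof. by case: z w => a c []. Qed.

Lemma ImB (z w : R[i]) : complex.Im (z - w) = complex.Im z - complex.Im w.
Proof. by case: z w => a c []. Qed.

Lemma repartB f g : repart (f \- g) = repart f - repart g.
Proof. by apply/funext => x; rewrite /repart fctE ReB. Qed.

Lemma impartB f g : impart (f \- g) = impart f - impart g.
Proof. by apply/funext => x; rewrite /impart fctE ImB. Qed.

Section Norms.
Variable mu : X -> R.
Hypothesis mu_gt0 : forall x, 0 < mu x.
Let wsqr_ge0 := weighted_sqr_ge0 mu_gt0.

Lemma l2sqnorm_parts f : (l2sqnorm mu f =
  \esum_(x in [set: X]) (mu x * (repart f x * repart f x))%:E +
  \esum_(x in [set: X]) (mu x * (impart f x * impart f x))%:E)%E.
Proof.
rewrite -esumD; first last.
- by move=> x _; rewrite lee_fin.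
- by move=> x _; rewrite lee_fin.
apply: eq_esum => x _; rewrite -EFinD /repart /impart; congr (_%:E).
by case: (f x) => a b /=; rewrite sqr_sqrtr ?addr_ge0 ?sqr_ge0 // mulrDr !expr2.
Qed.

Lemma l2P f : l2 mu f <-> L2 mu (repart f) /\ L2 mu (impart f).
Proof.
rewrite /l2 /= l2sqnorm_parts /L2 !abs_summable_ge0 //.
split=> [h|[h1 h2]]; last exact: lte_add_pinfty.
by split; apply: le_lt_trans h; [rewrite leeDl|rewrite leeDr] => //;
  apply: esum_ge0 => x _; rewrite lee_fin.
Qed.

Lemma l2sqnormE f : L2 mu (repart f) -> L2 mu (impart f) ->
  l2sqnorm mu f = (nrm mu (repart f) ^+ 2 + nrm mu (impart f) ^+ 2)%:E.
Proof. by move=> Lr Li; rewrite l2sqnorm_parts !esum_rsum // !sqr_nrm. Qed.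

Lemma L2_0 : L2 mu 0. Proof. exact: Cc_L2 (@Cc0 R X). Qed.

Lemma nrm0 : nrm mu 0 = 0. Proof. by rewrite /nrm ip0l sqrtr0. Qed.

Lemma l2norm_real f : impart f = 0 -> L2 mu (repart f) ->
  l2norm mu f = nrm mu (repart f).
Proof.
move=> f0 Lf; rewrite /l2norm l2sqnormE ?f0 //; last exact: L2_0.
by rewrite nrm0 expr0n /= addr0 sqrtr_sqr ger0_norm ?nrm_ge0.
Qed.

Lemma l2innerE f g : l2 mu f -> l2 mu g -> l2inner mu f g =
  ((ip mu (repart f) (repart g) + ip mu (impart f) (impart g)) +i*
   (ip mu (impart f) (repart g) - ip mu (repart f) (impart g)))%C.
Proof.
move=> /l2P[Lrf Lif] /l2P[Lrg Lig].
rewrite /l2inner /csum; congr (_ +i* _)%C.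
  rewrite -rsumD; [|exact: summable_mul|exact: summable_mul].
  congr rsum; apply/funext => x; rewrite /repart /impart.
  by case: (f x) (g x) => a b [c d] /=; ring.
rewrite -mulN1r -rsumZ; last exact: summable_mul.
rewrite -rsumD; first last.
- by apply: abs_summableZ; exact: summable_mul.
- exact: summable_mul.
congr rsum; apply/funext => x; rewrite /repart /impart.
by case: (f x) (g x) => a b [c d] /=; ring.
Qed.

End Norms.

Variable G : weighted_graph R X.
Local Notation mu := (gweight G).
Let mu_gt0 := gweight_gt0 G.
Local Notation L2 := (L2 mu).
Local Notation ip := (ip mu).
Local Notation nrm := (nrm mu).
Local Notation rschroedinger := (rschroedinger G).

Lemma finiteness_condition_real : finiteness_condition G ->
  forall x, L2 (fun y => gedge G x y / mu y).
Proof. by move=> hFC x; have /(l2P mu_gt0)[] := hFC x. Qed.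

Hypothesis FC : forall x, L2 (fun y => gedge G x y / mu y).

Lemma repart_schroedinger V f :
  repart (schroedinger G V f) = rschroedinger V (repart f).
Proof.
apply/funext => x; rewrite /repart /schroedinger ReD !Re_realM /=.
by congr (_ * rsum _ + _); apply/funext => y; rewrite Re_realM ReB.
Qed.

Lemma impart_schroedinger V f :
  impart (schroedinger G V f) = rschroedinger V (impart f).
Proof.
apply/funext => x; rewrite /impart /schroedinger ImD !Im_realM /=.
by congr (_ * rsum _ + _); apply/funext => y; rewrite Im_realM ImB.
Qed.

(** The graph norm consists of four squares: real and imaginary parts of the
    function and of its image. *)
Lemma sqr_lt_quarter (e t : R) : 0 < e -> 0 <= t -> t < Num.sqrt e / 2 ->
  t ^+ 2 < e / 4.
Proof.
move=> e0 t0 ts; have -> : e / 4 = (Num.sqrt e / 2) ^+ 2.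
  by rewrite exprMn sqr_sqrtr ?ltW // exprVn -natrX.
by rewrite ltr_sqr ?nnegrE // ltW.
Qed.

Lemma sqr_sum4_lt (a c a' c' e : R) : 0 <= a -> 0 <= c -> 0 <= a' -> 0 <= c' ->
  0 < e -> a ^+ 2 + c ^+ 2 + (a' ^+ 2 + c' ^+ 2) < e ^+ 2 ->
  [/\ a < e, c < e, a' < e & c' < e].
Proof.
move=> *; have := sqr_ge0 a; have := sqr_ge0 c; have := sqr_ge0 a'.
by have := sqr_ge0 c'; split; rewrite -ltr_sqr ?nnegrE ?(ltW (_ : 0 < e)) //;
  lra.
Qed.

Lemma l2sqnorm_graph V f g u : l2 mu f -> l2 mu g -> finitely_supported u ->
  (l2sqnorm mu (f \- u)%R + l2sqnorm mu (g \- schroedinger G V u)%R)%E =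
  (nrm (repart f - repart u) ^+ 2 + nrm (impart f - impart u) ^+ 2 +
   (nrm (repart g - rschroedinger V (repart u)) ^+ 2 +
    nrm (impart g - rschroedinger V (impart u)) ^+ 2))%:E.
Proof.
move=> /(l2P mu_gt0)[Lrf Lif] /(l2P mu_gt0)[Lrg Lig].
move=> /finitely_supportedP[cr ci].
have Lr := Cc_L2 mu cr; have Li := Cc_L2 mu ci.
have LLr := rschroedinger_L2 FC V cr; have LLi := rschroedinger_L2 FC V ci.
rewrite !l2sqnormE ?repartB ?impartB ?repart_schroedinger
  ?impart_schroedinger //; exact: L2B.
Qed.

(** The operator has real coefficients, so real and imaginary parts are
    approximated independently of each other. *)
Lemma closureP V f g : op_closure mu (schroedinger_Cc G V) (f, g) <->
  [/\ l2 mu f, l2 mu g, graph_approx G V (repart f) (repart g) &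
      graph_approx G V (impart f) (impart g)].
Proof.
split=> [[/= lf lg ap]|[lf lg apr api]].
  split=> // e e0; have [q [u fu <-]] := ap (e ^+ 2) (exprn_gt0 2 e0);
    have [cr ci] := (finitely_supportedP u).1 fu;
    rewrite /= l2sqnorm_graph // lte_fin =>
      /(sqr_sum4_lt (nrm_ge0 _ _) (nrm_ge0 _ _) (nrm_ge0 _ _) (nrm_ge0 _ _)
        e0)[];
    by [exists (repart u)|exists (impart u)].
split=> //= e e0; have s0 : 0 < Num.sqrt e / 2 by rewrite divr_gt0 ?sqrtr_gt0.
have [u [cu fu gu]] := apr _ s0; have [v [cv fv gv]] := api _ s0.
have fs : finitely_supported (assemble u v) by exact/finitely_supportedP.
exists (assemble u v, schroedinger G V (assemble u v)).
  by exists (assemble u v).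
rewrite /= l2sqnorm_graph // lte_fin.
have := sqr_lt_quarter e0 (nrm_ge0 _ _) fu.
have := sqr_lt_quarter e0 (nrm_ge0 _ _) gu.
have := sqr_lt_quarter e0 (nrm_ge0 _ _) fv.
have := sqr_lt_quarter e0 (nrm_ge0 _ _) gv.
rewrite /assemble /repart /impart /=; lra.
Qed.

Lemma graph_approx_refl V h : Cc h -> graph_approx G V h (rschroedinger V h).
Proof. by move=> ch e e0; exists h; rewrite !subrr nrm0. Qed.

Lemma eq0_of_norm_le (t K : R) : (forall e, 0 < e -> `|t| <= K * e) -> t = 0.
Proof.
move=> h; apply/eqP; rewrite -normr_le0 leNgt; apply/negP => t0.
have K0 : 0 < `|K| + 1 by rewrite ltr_wpDl.
have d0 : 0 < `|t| / 2 / (`|K| + 1) by rewrite !divr_gt0.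
have := h _ d0; have := divfK (lt0r_neq0 K0) (`|t| / 2).
move: d0; move: (_ / _ / _) => d d0 dE hd.
have : K * d <= `|K| * d by rewrite ler_wpM2r ?ler_norm // ltW.
by lra.
Qed.

(** Green's formula survives limits in the graph norm of f. *)
Lemma graph_approx_green V (f f' g : X -> R) : L2 f -> L2 f' -> L2 g ->
  L2 (rschroedinger V g) ->
  graph_approx G V f f' -> ip f' g = ip f (rschroedinger V g).
Proof.
move=> Lf Lf' Lg Lg' ap; apply/eqP; rewrite -subr_eq0; apply/eqP.
apply: (@eq0_of_norm_le _ (nrm g + nrm (rschroedinger V g))) => e e0.
have [u [cu fu fu']] := ap e e0.
have Lu := Cc_L2 mu cu; have LLu := rschroedinger_L2 FC V cu.
have L1 := L2B mu_gt0 Lf Lu; have L2' := L2B mu_gt0 Lf' LLu.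
have -> : ip f' g - ip f (rschroedinger V g) =
  ip (f' - rschroedinger V u) g - ip (f - u) (rschroedinger V g).
  by rewrite !ipBl // (green FC V cu Lg); ring.
apply: le_trans (ler_normB _ _) _.
have h1 := norm_ip mu_gt0 L2' Lg; have h2 := norm_ip mu_gt0 L1 Lg'.
have h3 : nrm (f' - rschroedinger V u) * nrm g <= e * nrm g.
  by rewrite ler_wpM2r ?nrm_ge0 // ltW.
have h4 : nrm (f - u) * nrm (rschroedinger V g) <= e * nrm (rschroedinger V g).
  by rewrite ler_wpM2r ?nrm_ge0 // ltW.
by lra.
Qed.

(** The formal operator is closed: test against point functions, which recover
    the values of both functions. *)
Lemma graph_approx_rschroedinger V (f f' : X -> R) : L2 f -> L2 f' ->
  graph_approx G V f f' ->
  rschroedinger V f = f'.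
Proof.
move=> Lf Lf' ap; apply/funext => y.
have cd := Cc_delta R y; have Ld := Cc_L2 mu cd.
have := graph_approx_green Lf Lf' Ld (rschroedinger_L2 FC V cd) ap.
rewrite (ipC _ f) (green FC V cd Lf) (ipC _ f') !ip_delta.
by move/(mulfI (lt0r_neq0 (mu_gt0 y))).
Qed.

Lemma closure_rschroedinger V f g :
  op_closure mu (schroedinger_Cc G V) (f, g) ->
  rschroedinger V (repart f) = repart g /\
  rschroedinger V (impart f) = impart g.
Proof.
move=> /closureP[/(l2P mu_gt0)[? ?] /(l2P mu_gt0)[? ?] ar ai].
by split; exact: graph_approx_rschroedinger.
Qed.

Lemma repart_cplx h : repart (cplx h) = h. Proof. by []. Qed.
Lemma impart_cplx h : impart (cplx h) = 0. Proof. by []. Qed.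

Lemma Cc_cplx h : Cc h -> finitely_supported (cplx h).
Proof. by move=> ch; apply/finitely_supportedP; split; [|exact: Cc0]. Qed.

Lemma Cc_closure V u : finitely_supported u ->
  op_closure mu (schroedinger_Cc G V) (u, schroedinger G V u).
Proof.
move=> /finitely_supportedP[cr ci]; apply/closureP.
split; rewrite ?repart_schroedinger ?impart_schroedinger;
  try exact: graph_approx_refl; apply/(l2P mu_gt0).
  by split; exact: Cc_L2.
by rewrite repart_schroedinger impart_schroedinger; split;
  exact: rschroedinger_L2.
Qed.

(** Together with [adjoint_rschroedinger], this identifies the adjoint of the
    closure with the maximal operator. *)
Lemma maximal_adjoint V f g : l2 mu f -> l2 mu g ->
  rschroedinger V (repart f) = repart g ->
  rschroedinger V (impart f) = impart g ->
  op_adjoint mu (op_closure mu (schroedinger_Cc G V)) (f, g).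
Proof.
move=> lf lg hr hi; split => // -[u v] uv /=.
have [lu lv ar ai] := (closureP V u v).1 uv.
rewrite !l2innerE // -hr -hi.
move: lf lg lu lv => /(l2P mu_gt0)[? ?] /(l2P mu_gt0)[? ?].
move=> /(l2P mu_gt0)[? ?] /(l2P mu_gt0)[? ?].
have LHr : L2 (rschroedinger V (repart f)) by rewrite hr.
have LHi : L2 (rschroedinger V (impart f)) by rewrite hi.
congr (_ +i* _)%C.
  by congr (_ + _); exact: graph_approx_green.
by congr (_ - _); exact: graph_approx_green.
Qed.

Lemma adjoint_rschroedinger V f g :
  op_adjoint mu (op_closure mu (schroedinger_Cc G V)) (f, g) ->
  [/\ l2 mu f, l2 mu g, rschroedinger V (repart f) = repart g &
      rschroedinger V (impart f) = impart g].
Proof.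
move=> [/= lf lg H].
have [Lrf Lif] := (l2P mu_gt0 f).1 lf; have [Lrg Lig] := (l2P mu_gt0 g).1 lg.
have key y : rschroedinger V (repart f) y = repart g y /\
    rschroedinger V (impart f) y = impart g y.
  have cd := Cc_delta R y; have fd := Cc_cplx cd.
  have q := Cc_closure V fd; have [ld lLd _ _] := (closureP _ _ _).1 q.
  move: (H _ q); rewrite /= !l2innerE // repart_schroedinger
    impart_schroedinger.
  rewrite !repart_cplx !impart_cplx (rschroedinger0 FC) !ip0l !addr0 !sub0r.
  case.
  rewrite !(green FC V cd) // !ip_delta => e1 /oppr_inj e2.
  by split; [move: e1|move: e2] => /(mulfI (lt0r_neq0 (mu_gt0 y))).
by split=> //; apply/funext => y; have [] := key y.
Qed.

(** The closure is always contained in its adjoint, the maximal operator, so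
    self-adjointness of the closure means that the maximal operator is contained
    in the closure. *)
Lemma ess_self_adjointP V :
  essentially_self_adjoint mu (schroedinger_Cc G V) <-> Cc_core G V.
Proof.
split=> [[_ sa] f Lf LLf|em].
  have : op_adjoint mu (op_closure mu (schroedinger_Cc G V))
      (cplx f, cplx (rschroedinger V f)).
    apply: maximal_adjoint;
      rewrite ?repart_cplx ?impart_cplx ?(rschroedinger0 FC) //;
      by apply/(l2P mu_gt0); split => //; exact: L2_0.
  by rewrite -sa => /closureP[].
split.
  move=> f lf e e0; have [Lr Li] := (l2P mu_gt0 f).1 lf.
  have s0 : 0 < Num.sqrt e / 2 by rewrite divr_gt0 ?sqrtr_gt0.
  have [u cu fu] := Cc_dense mu_gt0 Lr s0;
    have [v cv fv] := Cc_dense mu_gt0 Li s0.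
  have fs : finitely_supported (assemble u v) by exact/finitely_supportedP.
  exists (assemble u v, schroedinger G V (assemble u v));
    first exact: Cc_closure.
  have Lu := Cc_L2 mu cu; have Lv := Cc_L2 mu cv.
  have Lfu := L2B mu_gt0 Lr Lu; have Lfv := L2B mu_gt0 Li Lv.
  rewrite /= l2sqnormE ?repartB ?impartB //.
  rewrite lte_fin.
  have := sqr_lt_quarter e0 (nrm_ge0 _ _) fu.
  have := sqr_lt_quarter e0 (nrm_ge0 _ _) fv.
  by rewrite /assemble /repart /impart /=; lra.
apply/seteqP; split=> -[f g].
  move=> fg; have [lf lg _ _] := (closureP _ _ _).1 fg.
  by have [hr hi] := closure_rschroedinger fg; exact: maximal_adjoint.
move=> /adjoint_rschroedinger[lf lg hr hi]; apply/closureP.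
have [Lrf Lif] := (l2P mu_gt0 f).1 lf; have [Lrg Lig] := (l2P mu_gt0 g).1 lg.
by rewrite -hr -hi; split => //; apply: em; rewrite ?hr ?hi.
Qed.

End Complexification.

(** * Essential self-adjointness under relatively bounded perturbations *)

Local Open Scope complex_scope.

Theorem theorem2p2 (R : realType) (X : countType) (G : weighted_graph R X)
    (hconn : connected_graph G) (hFC : finiteness_condition G)
    (V V1 V2 : X -> R) (hV : forall x, V x = V1 x + V2 x)
    (hV2 : forall x, 0 <= V2 x)
    (hbelow : exists C : R, forall u : X -> R[i], finitely_supported u ->
      (C * l2norm (gweight G) u ^+ 2)%:C
        <= l2inner (gweight G) (schroedinger G V1 u) u)
    (hV1 : essentially_self_adjoint (gweight G) (schroedinger_Cc G V1))
    (hbound : exists a1 a2 : R, [/\ 0 <= a1, 0 <= a2 &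
      forall u : X -> R[i], finitely_supported u ->
        l2norm (gweight G) (fun x => (V2 x)%:C * u x)
          <= a1 * l2norm (gweight G) (schroedinger G V1 u)
             + a2 * l2norm (gweight G) u]) :
  essentially_self_adjoint (gweight G) (schroedinger_Cc G V).
Proof.
have FC := finiteness_condition_real hFC; have mu_gt0 := gweight_gt0 G.
have -> : V = V1 + V2 by apply/funext => x; rewrite hV.
have [C hC] := hbelow; have [a1 [a2 [a10 a20 hb]]] := hbound.
apply/(ess_self_adjointP FC).
have nrm_cplx u : Cc u ->
    l2norm (gweight G) (cplx u) = nrm (gweight G) u.
  by move=> cu; rewrite l2norm_real //; exact: Cc_L2.
have im0 u : impart (schroedinger G V1 (cplx u)) = 0.
  by rewrite impart_schroedinger // (rschroedinger0 FC).
apply: (Cc_core_perturb (C := C) FC hV2 _ a10 a20);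
  last exact/(ess_self_adjointP FC).
- move=> u cu; have Lu := Cc_L2 (gweight G) cu.
  have := hC _ (Cc_cplx cu); rewrite nrm_cplx // sqr_nrm // l2innerE //.
  + by rewrite lecE /= => /andP[_]; rewrite im0 ip0l addr0 repart_schroedinger.
  + apply/(l2P mu_gt0); rewrite im0 repart_schroedinger //.
    by split; [exact: rschroedinger_L2|exact: L2_0].
  + by apply/(l2P mu_gt0); split; [|exact: L2_0].
- move=> u cu; have Lu := Cc_L2 (gweight G) cu.
  have := hb _ (Cc_cplx cu); rewrite nrm_cplx //.
  rewrite (l2norm_real mu_gt0 (im0 u)) repart_schroedinger //;
    last exact: rschroedinger_L2.
  have r2 : repart (fun x => (V2 x)%:C * cplx u x) = V2 * u.
    by apply/funext => x; rewrite /repart Re_realM.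
  rewrite l2norm_real ?r2 //; last exact/Cc_L2/CcM.
  by apply/funext => x; rewrite /impart Im_realM mulr0.
Qed.
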